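(* Let $n\in\mathbb{N}\cup\{\infty\}$ and let $(G,+,0)$ be an abelian group. Let $\mathbf{c}=(c_i)_{i\in\mathbb{Z}_n}\in G^{\mathbb{Z}_n}$ and $\mathbf{d}=(d_i)_{i\in\mathbb{Z}_n}\in G^{\mathbb{Z}_n}$ be sequences such that $c_0=0$, $d_0=0$ and the group $G$ is generated by the set $\{c_i,d_i\mid i\in\mathbb{Z}_n\}$. Then $(Y,\lambda,\rho)=(G\times\mathbb{Z}_n^2,\lambda,\rho)$ with, for $(a,i,i'),(b,j,j')\in G\times\mathbb{Z}_n^2$, $$\lambda_{(a,i,i')}((b,j,j'))=(b+c_{i-i'+j'-j-1},\,j+1,\,j'),\qquad \rho_{(a,i,i')}((b,j,j'))=(b+d_{i-i'+j'-j+1},\,j,\,j'+1)$$ is an indecomposable solution of multipermutation level $2$.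
   Context: $\mathbb{N}$ denotes the positive integers, $\mathbb{Z}_n=\mathbb{Z}/n\mathbb{Z}$ for $n\in\mathbb{N}$, and $\mathbb{Z}_\infty=\mathbb{Z}$. A solution $(X,\sigma,\tau)$ is a set $X$ (of arbitrary cardinality) with families of bijections $\sigma_x,\tau_x:X\to X$ ($x\in X$) such that $r:X^2\to X^2$, $r(x,y)=(\sigma_x(y),\tau_y(x))$, satisfies the braid relation $(\mathrm{id}\times r)(r\times\mathrm{id})(\mathrm{id}\times r)=(r\times\mathrm{id})(\mathrm{id}\times r)(r\times\mathrm{id})$ on $X^3$. (That is, all solutions are set-theoretic and non-degenerate, not necessarily involutive.) A solution is indecomposable if the permutation group $\mathcal{G}(X)=\langle\sigma_x,\tau_x: x\in X\rangle$ acts transitively on $X$. Put $x\approx y$ iff $\sigma_x=\sigma_y$ and $\tau_x=\tau_y$. The operations induced on the quotient set $X/{\approx}$ are well defined and give a solution $\mathrm{Ret}(X)$, the retraction of $X$. Put $\mathrm{Ret}^0(X)=X$ and $\mathrm{Ret}^k(X)=\mathrm{Ret}(\mathrm{Ret}^{k-1}(X))$ for $k\ge 1$. If there is an integer $k$ such that $\mathrm{Ret}^k(X)$ has one element only, then $X$ is said to have multipermutation level $k$. In particular, $X$ is a permutation solution (multipermutation solution of level $1$) if $|\mathrm{Ret}(X)|=1$, and a non-permutation solution $X$ is said to be a multipermutation solution of level $2$ if $|\mathrm{Ret}(\mathrm{Ret}(X))|=1$.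
   Formalization: That Y is not a permutation solution (part of ''level 2'') is claimed only for nontrivial G: if G = 0 (e.g. n = 1) all λ coincide and all ρ coincide, so Y is a permutation solution; |Ret(Ret(Y))| = 1 is stated in all cases. *)

(* Defs.v *)
From mathcomp Require Import all_boot all_order all_algebra.
From mathcomp Require Import generic_quotient boolp.
Set Implicit Arguments.
Unset Strict Implicit.
Unset Printing Implicit Defensive.
Import GRing.Theory.

Local Open Scope quotient_scope.

Section Braiding.
Variables (X : Type) (sigma tau : X -> X -> X).

Definition braiding (p : X * X) : X * X := (sigma p.1 p.2, tau p.2 p.1).

Definition braiding_x_id (p : X * X * X) : X * X * X :=
  let: (x, y, z) := p in let: (x', y') := braiding (x, y) in (x', y', z).

Definition id_x_braiding (p : X * X * X) : X * X * X :=
  let: (x, y, z) := p in let: (y', z') := braiding (y, z) in (x, y', z').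

Record is_solution : Prop := IsSolution {
  sigma_bij : forall x, bijective (sigma x);
  tau_bij : forall x, bijective (tau x);
  braid_relation :
    id_x_braiding \o braiding_x_id \o id_x_braiding =1
    braiding_x_id \o id_x_braiding \o braiding_x_id }.

End Braiding.

(* Over classical logic every type carries a choiceType structure, so this
   puts no restriction on the underlying set. *)
Record solution := Solution {
  carrier :> choiceType;
  sigma : carrier -> carrier -> carrier;
  tau : carrier -> carrier -> carrier;
  solutionP : is_solution sigma tau }.

Section RetractionRelation.
Variables (X : Type) (sigma tau : X -> X -> X).

Definition retract_rel (x y : X) : bool :=
  `[< sigma x = sigma y /\ tau x = tau y >].

Lemma retract_relP x y :
  reflect (sigma x = sigma y /\ tau x = tau y) (retract_rel x y).
Proof. exact: asboolP. Qed.

Lemma retract_rel_refl : reflexive retract_rel.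
Proof. by move=> x; apply/retract_relP. Qed.

Lemma retract_rel_sym : symmetric retract_rel.
Proof. by move=> x y; apply/retract_relP/retract_relP => -[]. Qed.

Lemma retract_rel_trans : transitive retract_rel.
Proof.
move=> y x z /retract_relP[sxy txy] /retract_relP[syz tyz].
by apply/retract_relP; rewrite sxy txy.
Qed.

Canonical retract_equiv : equiv_rel X :=
  EquivRel retract_rel retract_rel_refl retract_rel_sym retract_rel_trans.

End RetractionRelation.

Lemma is_solution_mirror (X : Type) (s t : X -> X -> X) :
  is_solution s t -> is_solution t s.
Proof.
case=> sb tb br; split=> // -[[x y] z].
by have := br (z, y, x); rewrite /id_x_braiding /braiding_x_id /braiding /= =>
  -[-> -> ->].
Qed.

Lemma retract_rel_mirror (X : Type) (s t : X -> X -> X) x y :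
  retract_rel s t x y = retract_rel t s x y.
Proof. by apply/retract_relP/retract_relP => -[]. Qed.

Section Congruence.
Variables (X : Type) (s t : X -> X -> X).
Hypothesis st : is_solution s t.

Let sI x : injective (s x). Proof. exact: bij_inj (sigma_bij st x). Qed.
Let tI x : injective (t x). Proof. exact: bij_inj (tau_bij st x). Qed.
Let sS x y : exists z, s x z = y.
Proof. by case: (sigma_bij st x) => g _ gK; exists (g y). Qed.
Let tS x y : exists z, t x z = y.
Proof. by case: (tau_bij st x) => g _ gK; exists (g y). Qed.

Lemma braid_sigma x y z : s x (s y z) = s (s x y) (s (t y x) z).
Proof. by have := braid_relation st (x, y, z); case. Qed.

Lemma braid_mid x y z : t (s (t y x) z) (s x y) = s (t (s y z) x) (t z y).
Proof. by have := braid_relation st (x, y, z); case. Qed.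

Lemma braid_tau x y z : t z (t y x) = t (t z y) (t (s y z) x).
Proof. by have := braid_relation st (x, y, z); case. Qed.

Lemma retract_sigma x y y' : retract_rel s t y y' ->
  retract_rel s t (s x y) (s x y').
Proof.
move=> /retract_relP[ys yt]; apply/retract_relP; split; apply/funext => z.
  by have [v <-] := sS (t y x) z; rewrite -braid_sigma [in RHS]yt -braid_sigma ys.
by apply: (@tI (t y x)); rewrite -braid_tau [in RHS]yt -braid_tau yt.
Qed.

Lemma diag_surj y : exists x, s x y = x.
Proof.
have [z zy] := tS y y; exists (s z y); suff -> : s (s z y) = s z by [].
by apply/funext => v; have [w <-] := sS y v; rewrite [RHS]braid_sigma zy.
Qed.

Lemma diag_mid p x y : s p x = p ->
  t (s x y) p = s (t (s x y) p) (t y x).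
Proof.
move=> px; rewrite -braid_mid px; congr (t _ p).
by apply: (@sI p); rewrite braid_sigma px.
Qed.

Lemma retract_sigma_inj x y y' : retract_rel s t (s x y) (s x y') ->
  retract_rel s t y y'.
Proof.
move=> /retract_relP[us ut].
have w : t y x = t y' x.
  have [p px] := diag_surj x; apply: (@sI (t (s x y) p)).
  by rewrite -diag_mid // [in RHS]ut -diag_mid // ut.
apply/retract_relP; split; apply/funext => v.
  by apply: (@sI x); rewrite [LHS]braid_sigma us w -braid_sigma.
by have [z <-] := tS x v; rewrite [LHS]braid_tau ut w -braid_tau.
Qed.

End Congruence.

Section Retraction.
Variable X : solution.

Definition ret_carrier : choiceType :=
  {eq_quot (retract_equiv (@sigma X) (@tau X))}.

Definition ret_class (x : X) : ret_carrier :=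
  \pi_{eq_quot (retract_equiv (@sigma X) (@tau X))} x.

(* Independence of the representatives is [ret_sigmaE] and [ret_tauE] below. *)
Definition ret_sigma (a b : ret_carrier) : ret_carrier :=
  ret_class (sigma (repr a) (repr b)).

Definition ret_tau (a b : ret_carrier) : ret_carrier :=
  ret_class (tau (repr a) (repr b)).

Lemma ret_classP x y :
  ret_class x = ret_class y <-> retract_rel (@sigma X) (@tau X) x y.
Proof. by split=> [/eqquotP|h]; last apply/eqquotP. Qed.

Lemma ret_class_surj (a : ret_carrier) : exists x, ret_class x = a.
Proof. by exists (repr a); exact: reprK. Qed.

Lemma retract_repr x :
  retract_rel (@sigma X) (@tau X) (repr (ret_class x)) x.
Proof. by apply/ret_classP; exact: reprK. Qed.

Lemma ret_sigmaE x y :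
  ret_sigma (ret_class x) (ret_class y) = ret_class (sigma x y).
Proof.
rewrite /ret_sigma; have /retract_relP[-> _] := retract_repr x.
exact/ret_classP/(retract_sigma (solutionP X))/retract_repr.
Qed.

Lemma ret_tauE x y :
  ret_tau (ret_class x) (ret_class y) = ret_class (tau x y).
Proof.
rewrite /ret_tau; have /retract_relP[_ ->] := retract_repr x.
apply/ret_classP; rewrite retract_rel_mirror.
apply: (retract_sigma (is_solution_mirror (solutionP X))).
by rewrite retract_rel_mirror retract_repr.
Qed.

Lemma ret_is_solution : is_solution ret_sigma ret_tau.
Proof.
have bij (f : ret_carrier -> ret_carrier) : injective f ->
    (forall b, exists a, f a = b) -> bijective f.
  move=> fI /choice[g gK]; exists g => // a; exact/fI/gK.
have XP := solutionP X; split.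
- move=> a; have [x <-] := ret_class_surj a; apply: bij => [b b'|b].
    have [y <-] := ret_class_surj b; have [y' <-] := ret_class_surj b'.
    by rewrite !ret_sigmaE !ret_classP; exact: retract_sigma_inj.
  have [y <-] := ret_class_surj b; have [g _ gK] := sigma_bij XP x.
  by exists (ret_class (g y)); rewrite ret_sigmaE gK.
- move=> a; have [x <-] := ret_class_surj a; apply: bij => [b b'|b].
    have [y <-] := ret_class_surj b; have [y' <-] := ret_class_surj b'.
    rewrite !ret_tauE !ret_classP !(retract_rel_mirror (@sigma X)).
    exact/retract_sigma_inj/is_solution_mirror.
  have [y <-] := ret_class_surj b; have [g _ gK] := tau_bij XP x.
  by exists (ret_class (g y)); rewrite ret_tauE gK.
- move=> [[a b] c]; have [x <-] := ret_class_surj a.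
  have [y <-] := ret_class_surj b; have [z <-] := ret_class_surj c.
  have := braid_relation XP (x, y, z).
  rewrite /id_x_braiding /braiding_x_id /braiding /=.
  by rewrite !(ret_sigmaE, ret_tauE) => -[-> -> ->].
Qed.

Definition Ret : solution := Solution ret_is_solution.

End Retraction.

Section Properties.
Variable X : solution.

Inductive perm_group : (X -> X) -> Prop :=
| perm_group_sigma x : perm_group (sigma x)
| perm_group_tau x : perm_group (tau x)
| perm_group_id : perm_group id
| perm_group_comp f g : perm_group f -> perm_group g -> perm_group (f \o g)
| perm_group_inv f g :
    perm_group f -> cancel f g -> cancel g f -> perm_group g.

Definition indecomposable : Prop :=
  forall x y : X, exists2 f, perm_group f & f x = y.

Definition one_element (T : Type) : Prop := exists x : T, forall y, y = x.

(* Only [Ret^k(X)] is constrained: [k] is not required to be minimal. *)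
Definition multipermutation_level (k : nat) : Prop :=
  one_element (iter k Ret X).

Definition permutation_solution : Prop := one_element (Ret X).

End Properties.

Local Open Scope ring_scope.

(* [Some n] stands for n, [None] for infinity. ['I_n.-1.+1] is used because
   ['Z_n] is not the trivial group for n = 1; [Zmod (Some 0)] is junk. *)
Definition Zmod (n : option nat) : zmodType :=
  if n is Some m then 'I_m.-1.+1 : zmodType else int : zmodType.

Definition Zmod1 (n : option nat) : Zmod n :=
  match n return Zmod n with
  | Some m => inZp 1 : 'I_m.-1.+1
  | None => 1%:Z
  end.

Definition generates (G : zmodType) (S : G -> Prop) : Prop :=
  forall H : G -> Prop,
    H 0 -> (forall g h, H g -> H h -> H (g - h)) ->
    (forall g, S g -> H g) -> forall g, H g.

Section Construction.
Variables (n : option nat) (G : zmodType).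

Definition lambda (c : Zmod n -> G) (x y : G * Zmod n * Zmod n) :
    G * Zmod n * Zmod n :=
  let: (a, i, i') := x in let: (b, j, j') := y in
  (b + c (i - i' + j' - j - Zmod1 n), j + Zmod1 n, j').

Definition rho (d : Zmod n -> G) (x y : G * Zmod n * Zmod n) :
    G * Zmod n * Zmod n :=
  let: (a, i, i') := x in let: (b, j, j') := y in
  (b + d (i - i' + j' - j + Zmod1 n), j, j' + Zmod1 n).

End Construction.

(* Main.v *)
Require Import Defs.
From mathcomp Require Import all_boot all_order all_algebra.
From mathcomp Require Import boolp.
Import GRing.Theory.
Local Open Scope ring_scope.

(** Everything is controlled by the defect [i - i'] of a point [(a, i, i')]: a
    point [x] acts on others only through its defect, and [lambda] (resp. [rho])
    raises (resp. lowers) by one the defect of the point it acts on, while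
    translating its [G]-coordinate by a value of [c] (resp. [d]) taken at the
    difference of the two defects, up to a shift ([lambdaE], [rhoE]).

    The braid relation follows since both of its sides involve the same values
    of [c] and [d]: a common shift of two defects cancels in their difference,
    and raising the defect of the point acted on changes the index in the same
    way as lowering the defect of the acting point.

    The orbit of [(a, i, i')] contains [(a, i + 1, i')] and [(a, i, i' + 1)]
    because a point acting on it can be given the defect that makes the index
    zero, where [c] and [d] vanish.  Choosing instead the defect that makes the
    index [k] and undoing the shift of [i] or [i'] translates [a] by [c k] or
    [d k].  As [1] generates [Zmod n] and these values generate [G], the action
    is transitive ([orbit_generated] turns generation into transitivity).

    Points of equal defect are retraction equivalent, and the defect of
    [lambda c x y] or [rho d x y] does not depend on [x]; so the retraction is a
    permutation solution.  If the original solution were one too, [c] and [d]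
    would be constant, hence zero, and [G] would be trivial. *)

(** * Orbits of the permutation group *)

Lemma perm_group_bij (X : solution) (f : X -> X) : perm_group f -> bijective f.
Proof.
elim=> [x|x||{}f g _ fb _ gb|{}f g _ _ fK gK].
- exact: (sigma_bij (solutionP X)).
- exact: (tau_bij (solutionP X)).
- by exists id.
- exact: bij_comp.
- by exists f.
Qed.

Definition same_orbit (X : solution) (x y : X) : Prop :=
  exists2 f, perm_group f & f x = y.

Lemma same_orbit_refl (X : solution) (x : X) : same_orbit X x x.
Proof. by exists id => //; exact: perm_group_id. Qed.

Lemma same_orbit_sym (X : solution) (x y : X) :
  same_orbit X x y -> same_orbit X y x.
Proof.
case=> f fP <-; have [g fK gK] := perm_group_bij X f fP.
by exists g => //; exact: perm_group_inv fP fK gK.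
Qed.

Lemma same_orbit_trans (X : solution) (y x z : X) :
  same_orbit X x y -> same_orbit X y z -> same_orbit X x z.
Proof.
by move=> [f fP <-] [g gP <-]; exists (g \o f) => //; exact: perm_group_comp.
Qed.

Lemma same_orbit_sigma (X : solution) (x y : X) : same_orbit X y (sigma x y).
Proof. by exists (sigma x) => //; exact: perm_group_sigma. Qed.

Lemma same_orbit_tau (X : solution) (x y : X) : same_orbit X y (tau x y).
Proof. by exists (tau x) => //; exact: perm_group_tau. Qed.

(** The elements of [V] along which every translation of the family [p] stays
    inside an orbit form a subgroup, so it suffices to test generators. *)
Lemma orbit_generated (X : solution) (V : zmodType) (S : V -> Prop)
    (p : V -> X) :
  generates S -> (forall g v, S g -> same_orbit X (p v) (p (v + g))) ->
  forall v w, same_orbit X (p v) (p w).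
Proof.
move=> gen step v w; rewrite -[w](subrKC v); move: {w}(w - v) => g; move: g v.
apply: gen => [v|g h Hg Hh v|g Sg v]; last exact: step.
  by rewrite addr0; exact: same_orbit_refl.
rewrite [g - h]addrC addrA; apply: same_orbit_trans (Hg _).
(* [p v] and [p (v - h)] differ by the translation along [h] that starts at
   the latter. *)
by apply: same_orbit_sym; have := Hh (v - h); rewrite subrK.
Qed.

Lemma Zmod1_generates (n : option nat) :
  generates (fun g : Zmod n => g = Zmod1 n).
Proof.
move=> H H0 HB /(_ _ erefl) H1.
have HN g : H g -> H (- g) by rewrite -sub0r; exact: HB.
have HX k : H (Zmod1 n *+ k).
  elim: k => [|k IH]; rewrite ?mulr0n // mulrSr -[X in _ + X]opprK.
  exact: HB _ _ IH (HN _ H1).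
case: n H H0 HB H1 HN HX => [m|] H _ _ _ HN HX g.
  have -> : g = Zmod1 (Some m) *+ g
    by apply/val_inj; rewrite Zp_mulrn /= modnMml mul1n modn_small.
  exact: HX.
case: (intP g) => [|k|k].
- exact: (HX 0).
- by rewrite -[k.+1%:Z]natz; exact: HX.
- by rewrite -[k.+1%:Z]natz; exact/HN/HX.
Qed.

(** * The solution on G x Zmod n x Zmod n *)

Section Solution.
Variables (n : option nat) (G : zmodType) (c d : Zmod n -> G).
Local Notation one := (Zmod1 n).
Local Notation T := (G * Zmod n * Zmod n)%type.

Definition defect (x : T) : Zmod n := x.1.2 - x.2.

Lemma lambdaE (x y : T) : lambda c x y =
  (y.1.1 + c (defect x - defect y - one), y.1.2 + one, y.2).
Proof.
by case: x y => [[a i] i'] [[b j] j']; rewrite /defect /= opprB addrA.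
Qed.

Lemma rhoE (x y : T) : rho d x y =
  (y.1.1 + d (defect x - defect y + one), y.1.2, y.2 + one).
Proof.
by case: x y => [[a i] i'] [[b j] j']; rewrite /defect /= opprB addrA.
Qed.

Lemma defect_lambda x y : defect (lambda c x y) = defect y + one.
Proof. by rewrite lambdaE /defect /= addrAC. Qed.

Lemma defect_rho x y : defect (rho d x y) = defect y - one.
Proof. by rewrite rhoE /defect /= opprD addrA. Qed.

Lemma lambda_bij x : bijective (lambda c x).
Proof.
exists (fun y : T => (y.1.1 - c (defect x - defect y), y.1.2 - one, y.2)).
  move=> y; rewrite defect_lambda lambdaE /= (opprD (defect y)) addrA !addrK.
  by case: y => [[]].
move=> y; rewrite lambdaE /= subrK.
have -> : defect (y.1.1 - c (defect x - defect y), y.1.2 - one, y.2)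
          = defect y - one by rewrite /defect /= addrAC.
have -> : defect x - (defect y - one) - one = defect x - defect y.
  by rewrite (opprB (defect y)) addrA addrAC addrK.
by rewrite subrK; case: y => [[]].
Qed.

Lemma rho_bij x : bijective (rho d x).
Proof.
exists (fun y : T => (y.1.1 - d (defect x - defect y), y.1.2, y.2 - one)).
  move=> y; rewrite defect_rho rhoE /= (opprB (defect y)) addrA addrAC !addrK.
  by case: y => [[]].
move=> y; rewrite rhoE /= subrK.
have -> : defect (y.1.1 - d (defect x - defect y), y.1.2, y.2 - one)
          = defect y + one by rewrite /defect /= opprB addrA addrAC.
have -> : defect x - (defect y + one) + one = defect x - defect y.
  by rewrite (opprD (defect y)) addrA subrK.
by rewrite subrK; case: y => [[]].
Qed.

Lemma lambda_rho_solution : is_solution (lambda c) (rho d).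
Proof.
split; [exact: lambda_bij | exact: rho_bij | move=> [[x y] z]].
have shift_both (u v w : Zmod n) : (u + w) - (v + w) = u - v.
  by rewrite opprD addrACA subrr addr0.
have shift_one (u v w : Zmod n) : u - (v + w) = u - w - v.
  by rewrite opprD addrA addrAC.
rewrite /id_x_braiding /braiding_x_id /braiding /=; congr (_, _, _).
- rewrite lambdaE [RHS]lambdaE !(defect_lambda, defect_rho) !lambdaE /=.
  by rewrite defect_rho shift_both (shift_one _ (defect z)) [in RHS]addrAC.
- rewrite lambdaE [RHS]rhoE !(defect_lambda, defect_rho) lambdaE rhoE /=.
  by rewrite !shift_both addrAC.
- rewrite rhoE [RHS]rhoE !(defect_lambda, defect_rho) !rhoE /=.
  by rewrite defect_lambda shift_both (shift_one _ (defect x)) opprK [in LHS]addrAC.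
Qed.

Definition defect_solution : solution := Solution lambda_rho_solution.
Local Notation Y := defect_solution.

Lemma defect_indecomposable :
  c 0 = 0 -> d 0 = 0 ->
  generates (fun g : G => exists i : Zmod n, g = c i \/ g = d i) ->
  indecomposable Y.
Proof.
move=> c0 d0 gen; pose pt a i i' : Y := (a, i, i').
have index i i' (u : Zmod n) : i - i' + u + i' - i = u.
  by rewrite [_ + u]addrC addrA subrK addrK.
(* The index [k] is realised by an acting point whose defect is that of
   [pt a i i'] plus [k + 1] for [lambda], plus [k - 1] for [rho]. *)
have stepc a i i' k : same_orbit Y (pt a i i') (pt (a + c k) (i + one) i').
  have := same_orbit_sigma Y (pt 0 (i - i' + (k + one)) 0) (pt a i i').
  rewrite /sigma /= subr0 /pt.
  by rewrite index addrK.
have stepd a i i' k : same_orbit Y (pt a i i') (pt (a + d k) i (i' + one)).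
  have := same_orbit_tau Y (pt 0 (i - i' + (k - one)) 0) (pt a i i').
  rewrite /tau /= subr0 /pt.
  by rewrite index subrK.
have move_i a i' i j : same_orbit Y (pt a i i') (pt a j i').
  apply: (orbit_generated Y _ _ (fun i => pt a i i') (Zmod1_generates n)).
  by move=> _ k ->; have := stepc a k i' 0; rewrite c0 addr0.
have move_i' a i i' j' : same_orbit Y (pt a i i') (pt a i j').
  apply: (orbit_generated Y _ _ (fun i' => pt a i i') (Zmod1_generates n)).
  by move=> _ k ->; have := stepd a i k 0; rewrite d0 addr0.
have move_a i i' a b : same_orbit Y (pt a i i') (pt b i i').
  apply: (orbit_generated Y _ _ (fun a => pt a i i') gen) => _ {}a [k [->|->]].
    exact: same_orbit_trans (stepc _ _ _ k) (move_i _ _ _ _).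
  exact: same_orbit_trans (stepd _ _ _ k) (move_i' _ _ _ _).
move=> [[a i] i'] [[b j] j']; apply: same_orbit_trans (move_a i i' a b) _.
exact: same_orbit_trans (move_i b i' i j) (move_i' b j i' j').
Qed.

Lemma defect_retract (x y : Y) : defect x = defect y ->
  ret_class x = ret_class y.
Proof.
move=> xy; apply/ret_classP/retract_relP.
by split; apply/funext => z; rewrite /= ?lambdaE ?rhoE xy.
Qed.

Lemma defect_level2 : multipermutation_level Y 2.
Proof.
pose x0 : Y := (0, 0, 0); exists (ret_class (ret_class x0 : Ret Y)) => /= A.
have [B <-] := @ret_class_surj (Ret Y) A; have [x <-] := ret_class_surj B.
apply/(@ret_classP (Ret Y))/retract_relP.
split; apply/funext => C; have [y <-] := ret_class_surj C.
  rewrite /= !ret_sigmaE; apply: defect_retract.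
  by rewrite /sigma [LHS]defect_lambda [RHS]defect_lambda.
by rewrite /= !ret_tauE; apply: defect_retract; rewrite /tau [LHS]defect_rho [RHS]defect_rho.
Qed.

Lemma permutation_solution_trivial :
  c 0 = 0 -> d 0 = 0 ->
  generates (fun g : G => exists i : Zmod n, g = c i \/ g = d i) ->
  permutation_solution Y -> forall g : G, g = 0.
Proof.
move=> c0 d0 gen [A AP].
have same (x y : Y) : sigma x = sigma y /\ tau x = tau y.
  by apply/retract_relP/ret_classP; rewrite !(AP (ret_class _)).
pose pt i : Y := (0, i, 0).
apply: gen => // [g h -> ->|_ [k [->|->]]]; first by rewrite subr0.
(* The points [pt (k + 1)] and [pt 1] act on [pt 0] by [lambda] at the indices
   [k] and [0]; for [rho] the same holds of [pt (k - 1)] and [pt (- 1)]. *)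
  have [/(congr1 (fun f => (f (pt 0)).1.1)) + _] := same (pt (k + one)) (pt one).
  by rewrite /= !subr0 !addr0 !add0r addrK subrr c0.
have [_ /(congr1 (fun f => (f (pt 0)).1.1))] := same (pt (k - one)) (pt (- one)).
by rewrite /= !subr0 !addr0 !add0r subrK addNr d0.
Qed.

End Solution.

Theorem theorem5p1 (n : option nat) (hn : n <> Some 0%N) (G : zmodType)
    (c d : Zmod n -> G) (hc0 : c 0 = 0) (hd0 : d 0 = 0)
    (hgen : generates (fun g : G => exists i : Zmod n, g = c i \/ g = d i)) :
  exists sol : is_solution (lambda c) (rho d),
    let Y := Solution sol in
    [/\ indecomposable Y,
        multipermutation_level Y 2
      & (exists g : G, g <> 0) -> ~ permutation_solution Y].
Proof.
exists (lambda_rho_solution n G c d); split.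
- exact: defect_indecomposable.
- exact: defect_level2.
- by move=> [g g0] /permutation_solution_trivial triv; apply: g0; exact: triv.
Qed.
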